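(* Let $C=M^*(2)$ be the smallest nonassociative simple Moufang loop (of order $120$). For a $3$-tuple of integers $\mathbf s=(s_1,s_2,s_3)$ with $s_1\le s_2\le s_3$, let $p_{\mathbf s}(C)$ be the probability that $3$ randomly chosen elements $a_1,a_2,a_3$ of $C$ generate $C$ and the triple of orders $(|a_1|,|a_2|,|a_3|)$ is of type $\mathbf s$. Then $$p_{(2,2,2)}(C)=48384\cdot 120^{-3}=0.028,\qquad p_{(2,2,3)}(C)=326592\cdot 120^{-3}=0.189,$$ $$p_{(2,3,3)}(C)=435456\cdot 120^{-3}=0.252,\qquad p_{(3,3,3)}(C)=145152\cdot 120^{-3}=0.084.$$
   Context: $M^*(2)$ is the Paige loop over the two-element field $\mathbb F_2$: its elements are the Zorn vector matrices $\begin{pmatrix} a&\alpha\\ \beta&b\end{pmatrix}$ with $a,b\in\mathbb F_2$, $\alpha,\beta\in\mathbb F_2^3$ and $ab-\alpha\cdot\beta=1$, multiplied by $$\begin{pmatrix} a&\alpha\\ \beta&b\end{pmatrix}\begin{pmatrix} c&\gamma\\ \delta&d\end{pmatrix}=\begin{pmatrix} ac+\alpha\cdot\delta & a\gamma+d\alpha-\beta\times\delta\\ c\beta+b\delta+\alpha\times\gamma & \beta\cdot\gamma+bd\end{pmatrix},$$ where $\cdot$ and $\times$ are the usual dot and cross products on $\mathbb F_2^3$. It is a Moufang loop with $120$ elements; $|a|$ denotes the order of an element $a$. A triple of orders $(|a_1|,|a_2|,|a_3|)$ is of type $\mathbf s=(s_1,s_2,s_3)$ if it is a permutation of $(s_1,s_2,s_3)$.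 Thus $p_{\mathbf s}(C)=|C|^{-3}\cdot N$, where $N$ is the number of ordered triples $(a_1,a_2,a_3)\in C^3$ (repetitions allowed) such that the subloop generated by $a_1,a_2,a_3$ is $C$ and $(|a_1|,|a_2|,|a_3|)$ is a permutation of $\mathbf s$. *)

(* Defs.v *)
From HB Require Import structures.
From mathcomp Require Import all_boot all_order all_algebra ring.

Set Implicit Arguments.
Unset Strict Implicit.
Unset Printing Implicit Defensive.

Import GRing.Theory.
Local Open Scope ring_scope.

(* A loop is a unitary magma in which the equations x * z = y and z * x = y
   have unique solutions, denoted ldivg x y and rdivg y x. *)
HB.mixin Record UMagma_isLoop L of UMagma L := {
  ldivg : L -> L -> L;
  rdivg : L -> L -> L;
  mulKdg : forall x y : L, ldivg x (x * y)%g = y;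
  mulgKd : forall x y : L, (x * ldivg x y)%g = y;
  divgKd : forall x y : L, (rdivg y x * x)%g = y;
  mulgdK : forall x y : L, rdivg (y * x)%g x = y
}.

#[short(type="loopType")]
HB.structure Definition Loop := {L of UMagma_isLoop L & UMagma L}.

Definition dotv (u v : 'rV['F_2]_3) : 'F_2 := \sum_i u 0 i * v 0 i.

(* The indices are taken modulo 3. *)
Definition crossv (u v : 'rV['F_2]_3) : 'rV['F_2]_3 :=
  \row_i (u 0 (i + 1) * v 0 (i + 2) - u 0 (i + 2) * v 0 (i + 1)).

Record zorn : Type := Zorn {
  zul : 'F_2; zur : 'rV['F_2]_3;
  zdl : 'rV['F_2]_3; zdr : 'F_2
}.

Definition zorn_tuple z := (zul z, zur z, zdl z, zdr z).
Definition tuple_zorn t := let: (a, al, be, b) := t in Zorn a al be b.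
Lemma zorn_tupleK : cancel zorn_tuple tuple_zorn.
Proof. by case. Qed.

HB.instance Definition _ := Finite.copy zorn (can_type zorn_tupleK).

Definition zdet z : 'F_2 := zul z * zdr z - dotv (zur z) (zdl z).

Definition zmul x y : zorn :=
  let: Zorn a al be b := x in let: Zorn c ga de d := y in
  Zorn (a * c + dotv al de)
       (a *: ga + d *: al - crossv be de)
       (c *: be + b *: de + crossv al ga)
       (dotv be ga + b * d).

Definition zone : zorn := Zorn 1 0 0 1.

Definition zconj z : zorn := Zorn (zdr z) (- zur z) (- zdl z) (zul z).

Definition zscale (c : 'F_2) z : zorn :=
  Zorn (c * zul z) (c *: zur z) (c *: zdl z) (c * zdr z).

Lemma dotvE u v : dotv u v =
  u 0 0 * v 0 0 + u 0 1 * v 0 1 + u 0 (1 + 1) * v 0 (1 + 1).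
Proof.
rewrite /dotv !big_ord_recr big_ord0 /= add0r.
by congr (_ * _ + _ * _ + _ * _); congr (_ 0 _); apply: val_inj.
Qed.

Lemma forall_I3 (P : 'I_3 -> Prop) : P 0 -> P 1 -> P (1 + 1) -> forall i, P i.
Proof.
move=> P0 P1 P2 [[|[|[|//]]] lti].
- by rewrite (_ : Ordinal lti = 0) //; apply: val_inj.
- by rewrite (_ : Ordinal lti = 1) //; apply: val_inj.
- by rewrite (_ : Ordinal lti = 1 + 1) //; apply: val_inj.
Qed.

Lemma I3E : ((1 + 1 + 1 : 'I_3) = 0) * ((1 + (1 + 1) : 'I_3) = 0)
  * ((1 + 1 + (1 + 1) : 'I_3) = 1) * ((0 + 1 : 'I_3) = 1)
  * ((0 + (1 + 1) : 'I_3) = 1 + 1) * ((2 : 'I_3) = 1 + 1).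
Proof. by do !split; apply: val_inj. Qed.

Ltac zorn_ring :=
  repeat match goal with z : zorn |- _ => destruct z end;
  rewrite /zmul /zdet /zscale /zconj /zone /=;
  try congr Zorn; try (apply/rowP; apply: forall_I3);
  rewrite ?dotvE ?mxE ?I3E; ring.

Lemma zdetM x y : zdet (zmul x y) = zdet x * zdet y.
Proof. zorn_ring. Qed.

Lemma zmul1z : left_id zone zmul.
Proof. move=> x; zorn_ring. Qed.

Lemma zmulz1 : right_id zone zmul.
Proof. move=> x; zorn_ring. Qed.

Lemma zconjK : involutive zconj.
Proof. by case=> *; rewrite /zconj /= !opprK. Qed.

Lemma zmulKl x y : zmul (zconj x) (zmul x y) = zscale (zdet x) y.
Proof. zorn_ring. Qed.

Lemma zmulKr x y : zmul (zmul y x) (zconj x) = zscale (zdet x) y.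
Proof. zorn_ring. Qed.

Lemma zdet_conj x : zdet (zconj x) = zdet x.
Proof. zorn_ring. Qed.

Lemma zscale1 x : zscale 1 x = x.
Proof. by case: x => *; rewrite /zscale /= !mul1r !scale1r. Qed.

(* The Paige loop M^*(2); over the two-element field the scalars of norm 1
   are trivial, so no quotient is needed. *)
Record paige : Type := Paige { zorn_of :> zorn; _ : zdet zorn_of == 1 }.

HB.instance Definition _ := [isSub for zorn_of].
HB.instance Definition _ := [Finite of paige by <:].

Lemma zdet_paige (x : paige) : zdet x = 1.
Proof. exact/eqP/(valP x). Qed.

Fact zdet_one : zdet zone == 1.
Proof. by apply/eqP; zorn_ring. Qed.

Fact zdet_mul (x y : paige) : zdet (zmul x y) == 1.
Proof. by rewrite zdetM !zdet_paige mulr1. Qed.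

Fact zdet_inv (x : paige) : zdet (zconj x) == 1.
Proof. by rewrite zdet_conj zdet_paige. Qed.

Definition paige_one : paige := Paige zdet_one.
Definition paige_mul (x y : paige) : paige := Paige (zdet_mul x y).
Definition paige_inv (x : paige) : paige := Paige (zdet_inv x).

Fact paige_mul1 : left_id paige_one paige_mul.
Proof. by move=> x; apply: val_inj; apply: zmul1z. Qed.

Fact paige_mulx1 : right_id paige_one paige_mul.
Proof. by move=> x; apply: val_inj; apply: zmulz1. Qed.

HB.instance Definition _ := hasMul.Build paige paige_mul.
HB.instance Definition _ := Magma_isUMagma.Build paige paige_mul1 paige_mulx1.

Fact paige_invK (x : paige) : paige_inv (paige_inv x) = x.
Proof. by apply: val_inj; apply: zconjK. Qed.

Fact paige_mulKd (x y : paige) : paige_mul (paige_inv x) (x * y)%g = y.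
Proof.
by apply: val_inj; apply: etrans (zmulKl x y) _; rewrite zdet_paige zscale1.
Qed.

Fact paige_mulgKd (x y : paige) : (x * paige_mul (paige_inv x) y)%g = y.
Proof. by rewrite -{1}[x]paige_invK; apply: paige_mulKd. Qed.

Fact paige_mulgdK (x y : paige) : paige_mul (y * x)%g (paige_inv x) = y.
Proof.
by apply: val_inj; apply: etrans (zmulKr x y) _; rewrite zdet_paige zscale1.
Qed.

Fact paige_divgKd (x y : paige) : (paige_mul y (paige_inv x) * x)%g = y.
Proof. by rewrite -{2}[x]paige_invK; apply: paige_mulgdK. Qed.

HB.instance Definition _ := UMagma_isLoop.Build paige
  paige_mulKd paige_mulgKd paige_divgKd paige_mulgdK.

Definition subloop (H : {set paige}) : bool :=
  (1%g \in H) &&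
  [forall x in H, forall y in H,
     [&& (x * y)%g \in H, ldivg x y \in H & rdivg x y \in H]].

Definition subloop_gen (A : {set paige}) : {set paige} :=
  \bigcap_(H : {set paige} | subloop H && (A \subset H)) H.

Lemma exists_paige_exp (x : paige) : exists n, (0 < n)%N && ((x ^+ n)%g == 1%g).
Proof.
have xI : injective (fun y : paige => x * y)%g by exact: can_inj (mulKdg x).
exists (order (fun y : paige => x * y)%g 1%g).
rewrite order_gt0; apply/eqP; rewrite -[RHS](iter_order xI 1%g).
by elim: (order _ _) => // n IHn; rewrite expgS IHn.
Qed.

(* x ^+ n is x * (x * ... (x * x)); in a Moufang loop the bracketing is
   irrelevant. *)
Definition paige_order (x : paige) : nat := ex_minn (exists_paige_exp x).

Definition of_type (s : 3.-tuple nat) (a : 3.-tuple paige) : bool :=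
  perm_eq [seq paige_order x | x <- a] s.

(* p_s(M^*(2)), for the uniform distribution on ordered triples *)
Definition gen_prob (s : 3.-tuple nat) : rat :=
  #|[set a : 3.-tuple paige |
      (subloop_gen [set x in a] == [set: paige]) && of_type s a]|%:R
  / #|{: paige}|%:R ^+ 3.

(* Main.v *)
Require Import Defs.
From mathcomp Require Import all_boot all_order all_algebra ring.
Local Open Scope ring_scope.

(* Conjugation by an element w of a Moufang loop with w^3 = 1 is an
   automorphism, and three such conjugations already act transitively on the 63
   involutions and on the 56 elements of order 3.  Hence the number of
   generating triples (a, b, c) with prescribed orders is 63 or 56 times the
   number of pairs (b, c) completing one fixed element a.  These pairs are
   counted by computation on a binary encoding of the Zorn matrices.  For fixed
   a and b, the elements c fall into those lying in a closed proper subset that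
   contains a and b, and those for which <a, b, c> is everything; the latter
   are stable under c |-> (h c) k with h, k in <a, b>, so few closures have to
   be computed. *)

Set Implicit Arguments.
Unset Strict Implicit.
Unset Printing Implicit Defensive.

Import GRing.Theory.

(** * Finite sets of bit sequences as binary tries *)

Inductive trie := Nil | Node of trie & bool & trie.

Fixpoint tmem t s :=
  match t, s with
  | Nil, _ => false
  | Node _ b _, [::] => b
  | Node l _ r, x :: s' => if x then tmem l s' else tmem r s'
  end.

Fixpoint tadd s t :=
  let: (l, b, r) := if t is Node l b r then (l, b, r) else (Nil, false, Nil) in
  match s with
  | [::] => Node l true r
  | x :: s' => if x then Node (tadd s' l) b r else Node l b (tadd s' r)
  end.

Definition tadds t ss := foldl (fun u s => tadd s u) t ss.

Lemma tmem_add s t s' : tmem (tadd s t) s' = (s' == s) || tmem t s'.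
Proof.
elim: s t s' => [|x s IHs] t s' /=; first by case: t s' => [|l b r] [|[] s'].
by case: t s' x => [|l b r] [|[] s'] [] //=; rewrite IHs eqseq_cons.
Qed.

Lemma tmem_adds t ss s : tmem (tadds t ss) s = (s \in ss) || tmem t s.
Proof.
elim: ss t => [|s1 ss IHss] t //=.
by rewrite IHss tmem_add inE orbCA orbA.
Qed.

(** * Orbit enumeration *)

(** A worklist search with fuel [n]: [seen] lists what was found, while the trie [t] stores the same
    elements for fast membership tests. *)
Fixpoint reach n (fs : seq (bitseq -> bitseq)) todo seen t : seq bitseq :=
  match n, todo with
  | n'.+1, x :: todo' =>
    if tmem t x then reach n' fs todo' seen t
    else reach n' fs ([seq f x | f <- fs] ++ todo') (x :: seen) (tadd x t)
  | _, _ => seen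
  end.

(* Running out of fuel only yields fewer elements; every use checks separately
   that enough of them were found. *)
Definition orbit_of fs todo := reach 2000 fs todo [::] Nil.

Lemma orbit_of_ind (P : bitseq -> Prop) fs todo :
    {in todo, forall s, P s} ->
    (forall s, P s -> {in [seq f s | f <- fs], forall u, P u}) ->
  {in orbit_of fs todo, forall s, P s}.
Proof.
move=> Ptodo Pfs; rewrite /orbit_of.
suff gen n t seen : {in seen, forall s, P s} ->
    {in reach n fs todo seen t, forall s, P s}.
  exact: gen.
elim: n t seen todo Ptodo => [|n IHn] t seen [|x todo] //= Ptodo Pseen.
have Px : P x by apply: Ptodo; rewrite mem_head.
have Ptodo' : {in todo, forall s, P s}.
  by move=> s sP; apply: Ptodo; rewrite inE sP orbT.
case: ifP => _; first exact: IHn.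
apply: IHn => s; first by rewrite mem_cat => /orP[/(Pfs _ Px)|/Ptodo'].
by rewrite inE => /predU1P[->|/Pseen].
Qed.

(** * Binary encoding of the Paige loop *)

(** The bits are those of a, alpha, beta, b in this order. In characteristic 2 addition is xor and
    the signs in the Zorn product vanish. *)
Definition cmul (s t : bitseq) : bitseq :=
  match s, t with
  | [:: a; p1; p2; p3; q1; q2; q3; b], [:: c; r1; r2; r3; s1; s2; s3; d] =>
    [:: (a && c) (+) (p1 && s1 (+) p2 && s2 (+) p3 && s3);
        (a && r1) (+) (d && p1) (+) (q2 && s3 (+) q3 && s2);
        (a && r2) (+) (d && p2) (+) (q3 && s1 (+) q1 && s3);
        (a && r3) (+) (d && p3) (+) (q1 && s2 (+) q2 && s1);
        (c && q1) (+) (b && s1) (+) (p2 && r3 (+) p3 && r2);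
        (c && q2) (+) (b && s2) (+) (p3 && r1 (+) p1 && r3);
        (c && q3) (+) (b && s3) (+) (p1 && r2 (+) p2 && r1);
        (q1 && r1 (+) q2 && r2 (+) q3 && r3) (+) (b && d)]
  | _, _ => [::]
  end.

Definition cinv (s : bitseq) : bitseq :=
  if s is [:: a; p1; p2; p3; q1; q2; q3; b] then
    [:: b; p1; p2; p3; q1; q2; q3; a] else [::].

Definition cdet (s : bitseq) : bool :=
  if s is [:: a; p1; p2; p3; q1; q2; q3; b] then
    (a && b) (+) (p1 && q1 (+) p2 && q2 (+) p3 && q3) else false.

Definition cone : bitseq :=
  [:: true; false; false; false; false; false; false; true].

(** The last case is order 3 because [codes_exponent] leaves no other order. *)
Definition corder s :=
  if s == cone then 1%N else if cmul s s == cone then 2 else 3.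

Definition cconj w s := cmul (cmul w s) (cinv w).

Fixpoint words n : seq bitseq :=
  if n is n'.+1 then
    [seq true :: s | s <- words n'] ++ [seq false :: s | s <- words n']
  else [:: [::]].

Definition codes := [seq s <- words 8 | cdet s].

Lemma mem_words n s : (s \in words n) = (size s == n).
Proof.
elim: n s => [|n IHn] [|x s] //=.
  by apply/negbTE; rewrite mem_cat; apply/norP; split; apply/mapP=> -[].
rewrite mem_cat eqSS -IHn.
have consI y : injective (cons y : bitseq -> bitseq) by move=> ? ? [].
have consF y : ((x :: s) \in [seq y :: u | u <- words n]) = (x == y) && (s \in words n).
  apply/mapP/andP => [[u uW [-> ->]]|[/eqP-> sW]]; last by exists s.
  by rewrite eqxx.
by rewrite !consF; case: (x); rewrite ?orbF.
Qed.

Definition nz (a : 'F_2) : bool := a != 0.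

Lemma nzD a b : nz (a + b) = nz a (+) nz b.
Proof. by case: a b => [[|[|//]] ?] [[|[|//]] ?]. Qed.

Lemma nzM a b : nz (a * b) = nz a && nz b.
Proof. by rewrite /nz mulf_eq0 negb_or. Qed.

Lemma nzN a : nz (- a) = nz a.
Proof. by rewrite /nz oppr_eq0. Qed.

Lemma nz_nat (b : bool) : nz b%:R = b.
Proof. by case: b. Qed.

Lemma nz_inj : injective nz.
Proof. by move=> [[|[|//]] ?] [[|[|//]] ?] // _; apply: val_inj. Qed.

Definition enc (z : zorn) : bitseq :=
  [:: nz (zul z); nz (zur z 0 0); nz (zur z 0 1); nz (zur z 0 (1 + 1));
      nz (zdl z 0 0); nz (zdl z 0 1); nz (zdl z 0 (1 + 1)); nz (zdr z)].

Definition dec (s : bitseq) : zorn :=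
  Zorn (nth false s 0)%:R (\row_(i < 3) (nth false s i.+1)%:R)
       (\row_(i < 3) (nth false s (4 + i))%:R) (nth false s 7)%:R.

Definition nzE := (nzD, nzM, nzN, nz_nat).

Lemma enc_mul x y : enc (zmul x y) = cmul (enc x) (enc y).
Proof.
case: x y => [a p q b] [c r s d].
by rewrite /enc /zmul /= !dotvE !mxE !I3E !nzE.
Qed.

Lemma enc_conj x : enc (zconj x) = cinv (enc x).
Proof. by case: x => a p q b; rewrite /enc /zconj /= !mxE !nzE. Qed.

Lemma enc_det x : nz (zdet x) = cdet (enc x).
Proof. by case: x => a p q b; rewrite /enc /zdet /= dotvE !nzE. Qed.

Lemma enc_inj : injective enc.
Proof.
case=> [a p q b] [c r s d] [] /nz_inj-> p0 p1 p2 q0 q1 q2 /nz_inj->.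
by congr Zorn; apply/rowP; apply: forall_I3; apply: nz_inj.
Qed.

Lemma decK s : size s = 8 -> enc (dec s) = s.
Proof.
do 8![case: s => [//|? s]]; case: s => // _.
by rewrite /enc /dec /= !mxE !nz_nat.
Qed.

Lemma encM (x y : paige) : enc (x * y)%g = cmul (enc x) (enc y).
Proof. exact: enc_mul. Qed.

Lemma enc1 : enc (1%g : paige) = cone.
Proof. by rewrite /enc /= !mxE. Qed.

Arguments enc : simpl never.
Arguments cmul : simpl never.
Arguments cinv : simpl never.

Lemma enc_paige_inj : injective (fun x : paige => enc x).
Proof. by move=> x y /enc_inj /val_inj. Qed.

Lemma enc_codes (x : paige) : enc x \in codes.
Proof. by rewrite mem_filter mem_words -enc_det zdet_paige. Qed.

Lemma codesP s : reflect (exists x : paige, s = enc x) (s \in codes).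
Proof.
apply: (iffP idP) => [|[x ->]]; last exact: enc_codes.
rewrite mem_filter mem_words => /andP[sdet /eqP /decK encK].
have decP : zdet (dec s) == 1.
  by apply/eqP/nz_inj; rewrite enc_det encK sdet.
by exists (Paige decP); rewrite /= encK.
Qed.

Lemma perm_codes : perm_eq [seq enc x | x : paige] codes.
Proof.
apply: uniq_perm => [||s].
- by rewrite map_inj_uniq ?enum_uniq //; exact: enc_paige_inj.
- by vm_compute.
by apply/imageP/codesP => [[x _ ->]|[x ->]]; exists x.
Qed.

Lemma card_paige : #|{: paige}| = 120.
Proof.
rewrite -(size_image (fun x : paige => enc x)) (perm_size perm_codes).
by vm_compute.
Qed.

Lemma big_codes (F : bitseq -> nat) :
  (\sum_(x : paige) F (enc x) = \sum_(s <- codes) F s)%N.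
Proof. by rewrite -(perm_big _ perm_codes) /= big_image. Qed.

Lemma codes_exponent : all (fun s =>
  [|| s == cone, cmul s s == cone | cmul s (cmul s s) == cone]) codes.
Proof. by vm_compute. Qed.

(** Orders are at most 3, so inverses are powers. Closure under products will then imply closure
    under both divisions. *)
Lemma codes_inverse : all (fun s =>
  (cinv s == s) || (cinv s == cmul s s)) codes.
Proof. by vm_compute. Qed.

Lemma enc_eq (x y : paige) : (enc x == enc y) = (x == y).
Proof. exact: (inj_eq enc_paige_inj x y). Qed.

Lemma paige_exponent (x : paige) :
  [|| x == 1%g, (x * x == 1)%g | (x * (x * x) == 1)%g].
Proof.
by rewrite -!enc_eq !encM enc1; apply: (allP codes_exponent) (enc_codes x).
Qed.

Lemma corderE (x : paige) : corder (enc x) =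
  if x == 1%g then 1%N else if (x * x == 1)%g then 2 else 3.
Proof. by rewrite /corder -encM -enc1 !enc_eq. Qed.

Lemma paige_orderE (x : paige) : paige_order x = corder (enc x).
Proof.
rewrite corderE /paige_order; case: ex_minnP => n /andP[n_gt0 /eqP xn1] minn.
have le m : (0 < m)%N -> (x ^+ m)%g = 1%g -> (n <= m)%N.
  by move=> m0 xm; apply: minn; rewrite m0 xm eqxx.
have expg3 : (x ^+ 3 = x * (x * x))%g by rewrite !expgS expg0 mulg1.
case: eqP (paige_exponent x) => [x1 _|x1]; last rewrite orFb.
  by apply/eqP; rewrite eqn_leq n_gt0 le // expg1.
case: eqP => [x2 _|x2]; last rewrite orFb => /eqP x3.
  have := le 2 isT; rewrite expg2 x2 => /(_ erefl).
  by case: n n_gt0 xn1 {minn le} => [|[|[|n]]] //; rewrite expg1.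
have := le 3 isT; rewrite expg3 x3 => /(_ erefl).
by case: n n_gt0 xn1 {minn le} => [|[|[|[|n]]]] //; rewrite ?expg1 ?expg2.
Qed.

(** * Subloops and generation *)

Lemma subloopP (H : {set paige}) : subloop H ->
  [/\ 1%g \in H, {in H &, forall x y, (x * y)%g \in H},
      {in H &, forall x y, ldivg x y \in H}
    & {in H &, forall x y, rdivg x y \in H}].
Proof.
case/andP=> H1 /forall_inP HP.
by split=> // x y /HP /forall_inP HxP /HxP /and3P[].
Qed.

Definition gen3 (a b c : paige) :=
  subloop_gen [set x in [tuple a; b; c]] == [set: paige].

Lemma gen3P a b c :
  reflect (forall H, subloop H -> a \in H -> b \in H -> c \in H -> H = setT)
          (gen3 a b c).
Proof.
apply: (iffP eqP) => [gen H sH aH bH cH | gen].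
  apply/eqP; rewrite -subTset -gen; apply: bigcap_inf; rewrite sH /=.
  by apply/subsetP=> x; rewrite !inE => /or3P[] /eqP->.
apply/eqP; rewrite -subTset; apply/bigcapsP=> H /andP[sH /subsetP sub].
by rewrite (gen H) //; apply: sub; rewrite !inE eqxx ?orbT.
Qed.

(** Quotients are unique solutions of equations, so a multiplicative bijection preserves them as
    well. *)
Lemma morph_subloop (f g : paige -> paige) (H : {set paige}) :
    cancel f g -> cancel g f -> {morph f : x y / (x * y)%g} ->
  subloop H -> subloop (f @^-1: H).
Proof.
move=> fK gK fM /subloopP[H1 HM Hl Hr].
have f1 : f 1%g = 1%g.
  by rewrite -[LHS](mulKdg (f 1%g)) -fM mulg1 -{2}[f 1%g]mulg1 mulKdg.
rewrite /subloop inE f1 H1; apply/forall_inP=> x; rewrite inE => xH.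
apply/forall_inP=> y; rewrite inE => yH; rewrite !inE fM HM //=; apply/andP; split.
  by rewrite -(mulKdg (f x) (f (ldivg x y))) -fM mulgKd Hl.
by rewrite -(mulgdK (f y) (f (rdivg x y))) -fM divgKd Hr.
Qed.

(** Preimages of subloops give one implication; the other is the same argument for the inverse [g],
    again a morphism. *)
Lemma morph_gen3 (f g : paige -> paige) a b c :
    cancel f g -> cancel g f -> {morph f : x y / (x * y)%g} ->
  gen3 (f a) (f b) (f c) = gen3 a b c.
Proof.
have imp f' g' a' b' c' : cancel f' g' -> cancel g' f' ->
    {morph f' : x y / (x * y)%g} -> gen3 a' b' c' -> gen3 (f' a') (f' b') (f' c').
  move=> fK gK fM /gen3P gen; apply/gen3P=> H sH aH bH cH.
  have eqT : f' @^-1: H = setT.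
    by apply: gen; rewrite ?inE //; exact: morph_subloop gK fM sH.
  by apply/setP=> x; rewrite -[x]gK in_setT; move/setP/(_ (g' x)): eqT; rewrite !inE.
move=> fK gK fM; apply/idP/idP; last exact: imp gK fM.
have gM : {morph g : x y / (x * y)%g}.
  by move=> x y; rewrite -{1}(gK x) -{1}(gK y) -fM fK.
by move/(imp g f _ _ _ gK fK gM); rewrite !fK.
Qed.

(** * Closures and the scan over the third generator *)

(* In the absence of associativity this set, closed under multiplication by the
   generators only, may be smaller than the generated subloop. *)
Definition closure_of (gs : seq bitseq) :=
  orbit_of (flatten [seq [:: cmul g; cmul^~ g] | g <- gs]) gs.

(** Multiplying by a generator on either side never leaves a subloop containing the generators. A
    closure that fills the loop thus certifies generation. *)
Lemma closure_of_sub (H : {set paige}) (gs : seq paige) :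
    subloop H -> {subset gs <= H} ->
  {in closure_of [seq enc g | g : paige <- gs],
    forall s, exists2 x, x \in H & s = enc x}.
Proof.
case/subloopP=> _ HM _ _ gsH; apply: orbit_of_ind => [s /mapP[g gP ->]|s [x xH ->] u].
  by exists g => //; apply: gsH.
rewrite map_flatten -!map_comp => /flatten_mapP[g /gsH gH] /=.
rewrite !inE => /orP[] /eqP->; first by exists (g * x)%g; [apply: HM | rewrite encM].
by exists (x * g)%g; [apply: HM | rewrite encM].
Qed.

Definition tfull t := all (tmem t) codes.

Definition proper_closed (K : seq bitseq) :=
  let t := tadds Nil K in
  [&& tmem t cone, all (fun x => all (fun y => tmem t (cmul x y)) K) K
    & ~~ tfull t].

Lemma proper_closed_gen3 K (a b c : paige) :
    proper_closed K -> enc a \in K -> enc b \in K -> enc c \in K ->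
  ~~ gen3 a b c.
Proof.
rewrite /proper_closed; set t := tadds _ _; case/and3P=> t1 /allP tM tN aK bK cK.
have tE s : tmem t s = (s \in K) by rewrite tmem_adds orbF.
pose H := [set x : paige | enc x \in K].
have HM : {in H &, forall x y, (x * y)%g \in H}.
  by move=> x y; rewrite !inE encM => xK yK; rewrite -tE (allP (tM _ xK)).
have invE (x : paige) : paige_inv x = x \/ paige_inv x = (x * x)%g.
  have: (enc (paige_inv x) == enc x) || (enc (paige_inv x) == enc (x * x)%g).
    by rewrite encM enc_conj; apply: (allP codes_inverse) (enc_codes x).
  by case/orP=> /eqP /enc_paige_inj; [left | right].
have HV : {in H, forall x, paige_inv x \in H}.
  by move=> x xH; case: (invE x) => -> //; apply: HM.
have sH : subloop H.
  rewrite /subloop inE enc1 -tE t1; apply/forall_inP=> x xH.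
  apply/forall_inP=> y yH; rewrite HM //=; apply/andP; split.
    exact: (HM (paige_inv x) y (HV x xH) yH).
  exact: (HM x (paige_inv y) xH (HV y yH)).
apply: contra tN => /gen3P /(_ H sH); rewrite !inE => /(_ aK bK cK) HT.
apply/allP=> _ /codesP[x ->]; rewrite tE.
by move/setP/(_ x): HT; rewrite !inE.
Qed.

Definition translates (H : seq bitseq) c :=
  [seq cmul (cmul h c) k | h <- H, k <- H].

(* In the pair gb, gb.1 collects elements c for which <a, b, c> is the whole loop
   and gb.2 elements lying with a and b in a proper closed set. *)
Definition scan_update a b c H K (gb : trie * trie) :=
  if tfull (tadds Nil K) then (tadds gb.1 (translates H c), gb.2) else
  if [&& proper_closed K, a \in K & b \in K] then (gb.1, tadds gb.2 K) else gb.

Definition scan_step a b H (gb : trie * trie) c :=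
  if tmem gb.1 c || tmem gb.2 c then gb
  else scan_update a b c H (closure_of [:: a; b; c]) gb.

Definition scan a b := foldl (scan_step a b (closure_of [:: a; b])) (Nil, Nil) codes.

(** Elements in neither trie stay undecided here; [table_complete] checks afterwards that none
    remain. *)
Definition scan_sound a b (gb : trie * trie) :=
  forall c : paige, (tmem gb.1 (enc c) -> gen3 a b c)
                 /\ (tmem gb.2 (enc c) -> ~~ gen3 a b c).

Definition spanned (gs : seq paige) (K : seq bitseq) :=
  forall H, subloop H -> {subset gs <= H} ->
  {in K, forall s, exists2 x, x \in H & s = enc x}.

Lemma scan_updateP (a b c : paige) H K gb :
    spanned [:: a; b] H -> spanned [:: a; b; c] K -> scan_sound a b gb ->
  scan_sound a b (scan_update (enc a) (enc b) (enc c) H K gb).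
Proof.
move=> spanH spanK sound; rewrite /scan_update; case: ifP => [full|_].
  move=> d; have [goodP badP] := sound d; split=> //=.
  rewrite tmem_adds => /orP[/allpairsP[[h k] /= [hH kH dE]]|//].
  apply/gen3P=> S sS aS bS dS.
  have [_ _ Sl Sr] := subloopP sS.
  have abS : {subset [:: a; b] <= S} by apply/allP; rewrite /= aS bS.
  have [x xS hE] := spanH S sS abS h hH.
  have [y yS kE] := spanH S sS abS k kH.
  have {}dE : d = ((x * c) * y)%g by apply: enc_paige_inj; rewrite !encM -hE -kE.
  (* From d = (x c) y with x, y in S, dividing by y on the right and by x on the left recovers c. *)
  have cS : c \in S by rewrite -(mulKdg x c) -(mulgdK y (x * c)%g) -dE Sl ?Sr.
  have abcS : {subset [:: a; b; c] <= S} by apply/allP; rewrite /= aS bS cS.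
  apply/setP=> z; rewrite inE.
  have := allP full _ (enc_codes z); rewrite tmem_adds orbF.
  by case/(spanK S sS abcS) => u uS /enc_paige_inj ->.
case: ifP => [/and3P[propK aK bK]|_]; last exact: sound.
move=> d; have [goodP badP] := sound d; split=> //=.
by rewrite tmem_adds => /orP[|//]; apply: proper_closed_gen3 propK aK bK.
Qed.

Lemma scanP (a b : paige) : scan_sound a b (scan (enc a) (enc b)).
Proof.
have spanC gs : spanned gs (closure_of [seq enc g | g : paige <- gs]).
  by move=> H; apply: closure_of_sub.
rewrite /scan; have: {subset codes <= codes} by [].
have: scan_sound a b (Nil, Nil) by [].
(* The induction runs over the scanned list only; the [codes] on the right of the inclusion stays
   fixed, so every scanned c is still the code of a loop element. *)
elim: {1 3}codes (Nil, Nil) => [//|c cs IHcs] gb sound sub.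
apply: IHcs => [|u uP]; last by apply: sub; rewrite inE uP orbT.
have /codesP[d ->] : c \in codes by apply: sub; rewrite mem_head.
rewrite /scan_step; case: ifP => _; first exact: sound.
by apply: scan_updateP sound; [apply: (spanC [:: a; b]) | apply: (spanC [:: a; b; d])].
Qed.

(** * Counting *)

Definition class q := [seq s <- codes | corder s == q].

Definition scan_table a := [seq (b, scan a b) | b <- codes].

Definition table_complete (t : seq (bitseq * (trie * trie))) :=
  all (fun e => all (fun c => tmem e.2.1 c || tmem e.2.2 c) codes) t.

Definition table_count (t : seq (bitseq * (trie * trie))) q r :=
  sumn [seq count (tmem e.2.1) (class r) | e <- t & corder e.1 == q].

Definition pair_count q r (a : paige) : nat :=
  \sum_(b : paige) \sum_(c : paige)
    [&& paige_order b == q, paige_order c == r & gen3 a b c].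

Lemma table_completeP (f : bitseq -> trie * trie) b c :
    table_complete [seq (s, f s) | s <- codes] -> b \in codes -> c \in codes ->
  tmem (f b).1 c || tmem (f b).2 c.
Proof.
rewrite /table_complete all_map => /allP complete /complete /allP complete_b.
exact: complete_b.
Qed.

(** With [f] a variable, simplification cannot start evaluating the scan. *)
Lemma table_countE (f : bitseq -> trie * trie) q r :
  table_count [seq (s, f s) | s <- codes] q r =
  (\sum_(s <- codes) \sum_(u <- codes)
     [&& corder s == q, corder u == r & tmem (f s).1 u])%N.
Proof.
rewrite /table_count filter_map -map_comp sumnE big_map big_filter big_mkcond.
apply: eq_bigr => s _ /=; case: eqP => _ /=; last by rewrite big1.
rewrite -sum1_count big_filter_cond big_mkcond; apply: eq_bigr => u _ /=.
by case: (_ && _).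
Qed.

Lemma pair_countE q r (a : paige) :
    table_complete (scan_table (enc a)) ->
  pair_count q r a = table_count (scan_table (enc a)) q r.
Proof.
move=> complete; rewrite table_countE.
pose good s u := tmem (scan (enc a) s).1 u.
(* Completeness puts c in one of the two tries, and soundness of each then makes membership in the
   first equivalent to generation. *)
have gen3E b c : gen3 a b c = good (enc b) (enc c).
  have [goodP badP] := scanP a b c.
  have /orP[gP|/badP genN] := table_completeP complete (enc_codes b) (enc_codes c).
    by rewrite /good gP goodP.
  by rewrite (negPf genN); apply/esym/negP=> /goodP; apply/negP.
pose F s u : nat := [&& corder s == q, corder u == r & good s u].
rewrite -[RHS]/(\sum_(s <- codes) \sum_(u <- codes) F s u)%N -big_codes.
apply: eq_bigr => b _; rewrite -(big_codes (F _)); apply: eq_bigr => c _.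
by rewrite !paige_orderE gen3E.
Qed.

(** * Invariance under conjugation by elements of order 3 *)

Definition conjugators : seq bitseq :=
  [:: [:: false; false; false; true; false; false; true; true];
      [:: false; false; false; true; false; true; true; true];
      [:: false; false; true; false; false; true; false; true]].

(** Checking all pairs of codes replaces the Moufang identities behind the automorphism property. *)
Lemma conjugators_morph :
  all (fun w => all (fun x => all (fun y =>
    cconj w (cmul x y) == cmul (cconj w x) (cconj w y)) codes) codes) conjugators.
Proof. by vm_compute. Qed.

(** Reindexing b and c along the conjugation turns one count into the other, since an automorphism
    preserves orders and generation. *)
Lemma pair_count_conj q r (w a : paige) :
  enc w \in conjugators -> pair_count q r (rdivg (w * a)%g w) = pair_count q r a.
Proof.
move=> wC; pose f y := rdivg (w * y)%g w; pose g y := ldivg w (y * w)%g.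
have fK : cancel f g by move=> x; rewrite /f /g divgKd mulKdg.
have gK : cancel g f by move=> x; rewrite /f /g mulgKd mulgdK.
have encf y : enc (f y) = cconj (enc w) (enc y).
  (* Right division in [paige] is by definition multiplication by the conjugate matrix. *)
  by rewrite -[f y]/((w * y) * paige_inv w)%g !encM enc_conj.
have fM : {morph f : x y / (x * y)%g}.
  move=> x y; apply: enc_paige_inj; rewrite encf (encM x y) (encM (f x) (f y)) !encf.
  have /allP wx := allP conjugators_morph _ wC.
  have /allP wxy := wx _ (enc_codes x).
  exact/eqP/wxy/enc_codes.
have f1 : f 1%g = 1%g by rewrite /f mulg1 -{1}(mul1g w) mulgdK.
have ordf x : paige_order (f x) = paige_order x.
  rewrite !paige_orderE /corder -!encM -enc1 !(inj_eq enc_paige_inj) -fM -{1 2}f1.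
  by rewrite !(inj_eq (can_inj fK)).
rewrite /pair_count (reindex f) /=; last by exists g => x _.
apply: eq_bigr => b _; rewrite (reindex f) /=; last by exists g => x _.
by apply: eq_bigr => c _; rewrite !ordf (morph_gen3 _ _ _ fK gK fM).
Qed.

Definition orbit_conj a := orbit_of [seq cconj w | w <- conjugators] [:: a].

Lemma pair_count_orbit q r (a x : paige) :
  enc x \in orbit_conj (enc a) -> pair_count q r x = pair_count q r a.
Proof.
pose P s := exists2 y : paige, pair_count q r y = pair_count q r a & s = enc y.
suff PP : {in orbit_conj (enc a), forall s, P s}.
  by case/PP => y <- /enc_paige_inj->.
apply: orbit_of_ind => [s /[!inE] /eqP->|s [y yE ->] u]; first by exists a.
rewrite -map_comp => /mapP[s' s'C ->].
have /codesP[w wE] : s' \in codes by move: s' s'C; apply/allP; vm_compute.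
exists (rdivg (w * y)%g w); first by rewrite pair_count_conj -?wE.
by rewrite -[rdivg _ _]/((w * y) * paige_inv w)%g !encM enc_conj -wE.
Qed.

(** The [let] shares one scan table among the four counts. The third test is transitivity: the
    conjugates of a exhaust the elements of order p. *)
Definition certificate p a (n : seq nat) :=
  let t := scan_table a in
  [&& a \in codes, table_complete t,
      all (tmem (tadds Nil (orbit_conj a))) (class p)
    & [:: table_count t 2 2; table_count t 2 3; table_count t 3 2;
          table_count t 3 3] == n].

Definition triple_count p q r : nat :=
  \sum_(a : paige | paige_order a == p) pair_count q r a.

Lemma triple_countE p a n22 n23 n32 n33 (m := size (class p)) :
    certificate p a [:: n22; n23; n32; n33] ->
  [/\ triple_count p 2 2 = m * n22, triple_count p 2 3 = m * n23,
      triple_count p 3 2 = m * n32 & triple_count p 3 3 = m * n33]%N.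
Proof.
case/and4P=> /codesP[{}a ->] complete orb.
rewrite !eqseq_cons => /and5P[/eqP n22E /eqP n23E /eqP n32E /eqP n33E _].
suff countE q r : triple_count p q r = (m * table_count (scan_table (enc a)) q r)%N.
  by rewrite !countE n22E n23E n32E n33E.
rewrite -(pair_countE q r complete) /triple_count.
(* By transitivity the summand is constant on the elements of order p. *)
rewrite (eq_bigr (fun=> pair_count q r a)) => [|x xp]; last first.
  apply: pair_count_orbit; have := allP orb (enc x); rewrite tmem_adds orbF; apply.
  by rewrite mem_filter enc_codes -paige_orderE xp.
rewrite big_mkcond (eq_bigr (fun x : paige =>
  if corder (enc x) == p then pair_count q r a else 0%N)) => [|x _]; last first.
  by rewrite paige_orderE.
rewrite (big_codes (fun s => if corder s == p then pair_count q r a else 0%N)).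
by rewrite -big_mkcond big_const_seq iter_addn_0 mulnC /m size_filter.
Qed.

(** Trace 0 and determinant 1 force the square to be 1. *)
Definition involution0 : bitseq :=
  [:: false; false; false; true; false; false; true; false].

(** Trace 1 and determinant 1 give x^2 = x + 1, hence x^3 = 1. *)
Definition order3elt0 : bitseq :=
  [:: false; false; false; true; false; false; true; true].

Lemma certificate2 : certificate 2 involution0 [:: 768; 1728; 1728; 2304].
Proof. by vm_compute. Qed.

(** The two certificates agree with the symmetry of generation under permuting a triple: 63 * 1728 =
    56 * 1944 and 63 * 2304 = 56 * 2592. *)
Lemma certificate3 : certificate 3 order3elt0 [:: 1944; 2592; 2592; 2592].
Proof. by vm_compute. Qed.

(** * From ordered triples of orders to types *)

Definition ordered_count (s : seq nat) : nat :=
  \sum_(a : paige) \sum_(b : paige) \sum_(c : paige)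
    (gen3 a b c && ([:: paige_order a; paige_order b; paige_order c] == s)).

Lemma ordered_countE p q r : ordered_count [:: p; q; r] = triple_count p q r.
Proof.
rewrite /triple_count big_mkcond; apply: eq_bigr => a _ /=.
have [ap|ap] := eqVneq (paige_order a) p.
  apply: eq_bigr => b _; apply: eq_bigr => c _.
  by rewrite !eqseq_cons ap eqxx andbT andTb andbC -andbA.
rewrite big1 // => b _; rewrite big1 // => c _.
by rewrite eqseq_cons (negPf ap) andbF.
Qed.

(** [permutations s] lists each distinct ordering once, so repeated orders in s cause no
    overcounting. *)
Lemma card_generating_type (s : 3.-tuple nat) :
  #|[set a : 3.-tuple paige |
      (subloop_gen [set x in a] == [set: paige]) && of_type s a]|
  = (\sum_(t <- permutations s) ordered_count t)%N.
Proof.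
rewrite cardsE -sum1_card big_mkcond /=.
(* Nested pairs parametrize the 3-tuples, which turns the cardinal into an iterated sum. *)
pose f (u : paige * (paige * paige)) := [tuple u.1; u.2.1; u.2.2].
rewrite (reindex f) /=; last first.
  exists (fun t => (thead t, (thead (behead_tuple t),
                              thead (behead_tuple (behead_tuple t))))).
    by case=> a [b c].
  move=> t _; case/tupleP: t => a t; case/tupleP: t => b t.
  by case/tupleP: t => c t; rewrite (tuple0 t); apply: val_inj.
pose g a b c : nat :=
  gen3 a b c && perm_eq [:: paige_order a; paige_order b; paige_order c] s.
transitivity (\sum_a \sum_b \sum_c g a b c)%N.
  rewrite (eq_bigr (fun a => \sum_u g a u.1 u.2)%N) => [|a _]; last first.
    by rewrite (pair_bigA _ (g a)).
  rewrite (pair_bigA _ (fun a u => g a u.1 u.2)); apply: eq_bigr => u _.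
  by rewrite unfold_in; case: ifP => h; exact/esym/(congr1 nat_of_bool h).
rewrite /ordered_count [RHS]exchange_big; apply: eq_bigr => a _.
rewrite [RHS]exchange_big; apply: eq_bigr => b _.
rewrite [RHS]exchange_big; apply: eq_bigr => c _.
rewrite /g -mem_permutations; case: (gen3 a b c) => /=; last by rewrite big1.
(* As the orderings are distinct, the membership indicator is the number of those equal to the
   triple of orders. *)
rewrite -count_uniq_mem ?permutations_uniq // -sum1_count big_mkcond /=.
by apply: eq_bigr => t _; rewrite eq_sym; case: eqP.
Qed.

Lemma gen_probE (s : 3.-tuple nat) ts : perm_eq (permutations s) ts ->
  gen_prob s = (\sum_(t <- ts) ordered_count t)%N%:R / 120 ^+ 3.
Proof.
by move=> /(perm_big ts) <-; rewrite /gen_prob card_generating_type card_paige.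
Qed.

Lemma size_class2 : size (class 2) = 63. Proof. by vm_compute. Qed.

Lemma size_class3 : size (class 3) = 56. Proof. by vm_compute. Qed.

Theorem proposition2p4 :
  [/\ gen_prob [tuple 2; 2; 2]%N = 48384%:R / 120 ^+ 3 :> rat
      /\ 48384%:R / 120 ^+ 3 = 0.028%Q :> rat,
      gen_prob [tuple 2; 2; 3]%N = 326592%:R / 120 ^+ 3 :> rat
      /\ 326592%:R / 120 ^+ 3 = 0.189%Q :> rat,
      gen_prob [tuple 2; 3; 3]%N = 435456%:R / 120 ^+ 3 :> rat
      /\ 435456%:R / 120 ^+ 3 = 0.252%Q :> rat
    & gen_prob [tuple 3; 3; 3]%N = 145152%:R / 120 ^+ 3 :> rat
      /\ 145152%:R / 120 ^+ 3 = 0.084%Q :> rat].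
Proof.
have := triple_countE certificate2; rewrite size_class2 => -[n222 n223 n232 n233].
have := triple_countE certificate3; rewrite size_class3 => -[n322 n323 n332 n333].
(* The decimal literals are hidden behind N because unifying them with natmul
   patterns expands them in unary. *)
split; split.
- set N := 48384%:R; rewrite (@gen_probE [tuple 2; 2; 2]%N [:: [:: 2; 2; 2]]%N isT).
  by rewrite big_seq1 ordered_countE n222 natrM /N; field.
- have -> : 0.028%Q = 28 / 1000 :> rat by apply/eqP.
  by field.
- set N := 326592%:R.
  (* [isT] verifies the list of orderings by evaluation; each of the three contributes 108864
     triples. *)
  rewrite (@gen_probE [tuple 2; 2; 3]%N
    [:: [:: 2; 2; 3]; [:: 2; 3; 2]; [:: 3; 2; 2]]%N isT).
  by rewrite !big_cons big_nil !ordered_countE !natrD n223 n232 n322 !natrM /N; field.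
- have -> : 0.189%Q = 189 / 1000 :> rat by apply/eqP.
  by field.
- set N := 435456%:R.
  rewrite (@gen_probE [tuple 2; 3; 3]%N
    [:: [:: 2; 3; 3]; [:: 3; 2; 3]; [:: 3; 3; 2]]%N isT).
  by rewrite !big_cons big_nil !ordered_countE !natrD n233 n323 n332 !natrM /N; field.
- have -> : 0.252%Q = 252 / 1000 :> rat by apply/eqP.
  by field.
- set N := 145152%:R; rewrite (@gen_probE [tuple 3; 3; 3]%N [:: [:: 3; 3; 3]]%N isT).
  by rewrite big_seq1 ordered_countE n333 natrM /N; field.
- have -> : 0.084%Q = 84 / 1000 :> rat by apply/eqP.
  by field.
Qed.
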